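(* Let $T$ be a tree of order $n\geq 3$. Then $\mathrm{sd}_{\gamma_t}(T)=1$ if and only if $T$ has (i) a leaf which does not belong to any $\gamma_t(T)$-set, or (ii) an inner edge $uv$ such that for every $\gamma_t(T)$-set $D$: (1) if $|\{u,v\}\cap D|=1$, say $u\in D$, then $v\in PN_T[u,D]$; and (2) if $|\{u,v\}\cap D|=2$, then $N_T(u)\cap D=\{v\}$ or $N_T(v)\cap D=\{u\}$; moreover, if $N_T(u)\cap D=\{v\}$, then $PN_T[u,D]\neq\emptyset$ and ($PN_T[v,D]\neq\emptyset$ or $N_T(x)\cap D=\{v\}$ for some vertex $x\in(N_T(v)\cap D)\setminus\{u\}$), and symmetrically, if $N_T(v)\cap D=\{u\}$, then $PN_T[v,D]\neq\emptyset$ and ($PN_T[u,D]\neq\emptyset$ or $N_T(x)\cap D=\{u\}$ for some vertex $x\in(N_T(u)\cap D)\setminus\{v\}$).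
   Context: A set $S\subseteq V(G)$ is a total dominating set of $G$ if every vertex of $G$ is adjacent to a vertex of $S$; $\gamma_t(G)$ is the minimum size of such a set and a $\gamma_t(G)$-set is a total dominating set of that size. A leaf is a vertex of degree 1; an inner edge is an edge not incident with a leaf. $N_T(v)$ is the open neighbourhood and $N_T[v]=N_T(v)\cup\{v\}$; for $X\subseteq V$, $N_T[X]=\bigcup_{x\in X}N_T[x]$. For $u\in D\subseteq V(T)$, $PN_T[u,D]=N_T[u]\setminus N_T[D\setminus\{u\}]$. $\mathrm{sd}_{\gamma_t}(G)$ is the minimum number of edges that must be subdivided (each edge at most once, i.e. replaced by a path of length 2 through a new vertex) to increase $\gamma_t$. *)

(* Defs.v *)
From mathcomp Require Import all_boot.

Set Implicit Arguments.
Unset Strict Implicit.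
Unset Printing Implicit Defensive.

(* A simple graph on a finite vertex type is a symmetric irreflexive
   adjacency relation; [is_tree] includes these two conditions. *)
Section Graph.
Variables (V : finType) (e : rel V).

(* Cycles have at least three vertices: a [ucycle] of length 2 merely
   traverses one edge back and forth. *)
Definition is_tree : Prop :=
  [/\ symmetric e, irreflexive e, forall x y, connect e x y
    & forall c : seq V, ucycle e c -> size c <= 2].

Definition edges : {set {set V}} :=
  [set [set p.1; p.2] | p : V * V & e p.1 p.2].

Definition onbh (v : V) : {set V} := [set w | e v w].

Definition cnbh (v : V) : {set V} := v |: onbh v.

Definition cnbhs (X : {set V}) : {set V} := \bigcup_(x in X) cnbh x.

Definition PN (u : V) (D : {set V}) : {set V} := cnbh u :\: cnbhs (D :\ u).

Definition leaf (v : V) : bool := #|onbh v| == 1.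

Definition inner_edge (u v : V) : bool := [&& e u v, ~~ leaf u & ~~ leaf v].

Definition total_dom (D : {set V}) : bool :=
  [forall v, exists w in D, e v w].

(* If the graph has an isolated vertex there is no total dominating set and
   this is #|V|, by the default case of [arg min]. *)
Definition gamma_t : nat := #|[arg min_(D < [set: V] | total_dom D) #|D|]|.

Definition gamma_t_set (D : {set V}) : bool :=
  total_dom D && (#|D| == gamma_t).

(* The edges in F are each replaced by a path of length 2; the new vertex on
   such a path is the edge itself. *)
Definition subdivide (F : {set {set V}}) : rel (V + {f : {set V} | f \in F}) :=
  fun a b =>
    match a, b with
    | inl x, inl y => e x y && ([set x; y] \notin F)
    | inl x, inr f => x \in val f
    | inr f, inl y => y \in val f
    | inr _, inr _ => false
    end.

End Graph.

(* Minimum size of an edge set whose subdivision increases the total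
   domination number; equal to #|edges e|.+1 if there is no such set. *)
Definition sd_gamma_t (V : finType) (e : rel V) : nat :=
  \big[minn/#|edges e|.+1]_(F : {set {set V}} |
      (F \subset edges e) && (gamma_t e < gamma_t (@subdivide V e F))) #|F|.

(* The requirement on a minimum total dominating set D containing both ends of
   the edge uv and satisfying N(u) :&: D = [set v]. *)
Definition end_condition (V : finType) (e : rel V) (D : {set V}) (u v : V)
    : Prop :=
  PN e u D != set0 /\
  (PN e v D != set0 \/
   exists2 x, x \in (onbh e v :&: D) :\ u & onbh e x :&: D = [set v]).

(* Main.v *)
Require Import Defs.
From mathcomp Require Import all_boot.

Set Implicit Arguments.
Unset Strict Implicit.
Unset Printing Implicit Defensive.

(* Since subdividing no edge does not raise gamma_t, sd = 1 means that some
   single edge uv raises it.  A total dominating set of the graph with uv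
   subdivided is a set D of old vertices, possibly together with the new vertex
   s.  Without s, D is total dominating in T, and it must contain u or v and
   give each of u and v a neighbour besides the other.  With s, and at most
   gamma_t vertices in all, D :|: [set u; v] is a gamma_t-set of T if uv is
   pendant; if uv is inner, D contains exactly one end, say u, and v |: D is a
   gamma_t-set in which u has no neighbour but v while no other vertex needs v,
   so the end condition fails.  Conversely, a gamma_t-set violating the
   condition becomes a total dominating set of the subdivided graph after
   exchanging at most one end of uv for s. *)

(** Turns a bound on [sd_gamma_t] into the existence of a single edge set. The default [d] always
    takes part in the minimum, hence the first disjunct. *)
Lemma leq_bigminn (I : Type) (r : seq I) (P : pred I) (f : I -> nat) d k :
  (\big[minn/d]_(i <- r | P i) f i <= k) =
  (d <= k) || has (fun i => P i && (f i <= k)) r.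
Proof.
elim: r => [|i r IHr]; first by rewrite big_nil orbF.
by rewrite big_cons /=; case: (P i); rewrite ?geq_min IHr // orbCA.
Qed.

(** * Total dominating sets and private neighbours *)

Section TotalDomination.
Variables (V : finType) (e : rel V).

Lemma total_domP (D : {set V}) :
  reflect (forall x, exists2 w, w \in D & e x w) (total_dom e D).
Proof. by apply: (iffP forallP) => dD x; apply/exists_inP. Qed.

Lemma total_domT (D : {set V}) : total_dom e D -> total_dom e [set: V].
Proof.
move/total_domP=> dD; apply/total_domP=> x.
by have [w _ exw] := dD x; exists w; rewrite ?inE.
Qed.

Lemma gamma_t_min (D : {set V}) : total_dom e D -> gamma_t e <= #|D|.
Proof.
move=> dD; rewrite /gamma_t; case: arg_minnP; first exact: total_domT dD.
by move=> M _; apply.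
Qed.

Lemma gamma_t_attained (D : {set V}) :
  total_dom e D -> exists M, gamma_t_set e M.
Proof.
move=> dD; rewrite /gamma_t_set /gamma_t.
case: arg_minnP => [|M dM _]; first exact: total_domT dD.
by exists M; rewrite dM eqxx.
Qed.

Lemma gamma_t_set_small (D : {set V}) :
  total_dom e D -> #|D| <= gamma_t e -> gamma_t_set e D.
Proof. by move=> dD leD; rewrite /gamma_t_set dD eqn_leq leD gamma_t_min. Qed.

(** The witness [D0] excludes the default case of the arg min. *)
Lemma gamma_t_leP (D0 : {set V}) k : total_dom e D0 ->
  reflect (exists2 D, total_dom e D & #|D| <= k) (gamma_t e <= k).
Proof.
move=> dD0; apply: (iffP idP) => [lek | [D dD]].
  have [M /andP[dM /eqP cM]] := gamma_t_attained dD0.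
  by exists M; rewrite ?cM.
by apply: leq_trans; apply: gamma_t_min.
Qed.

Lemma connected_total_domT :
  (forall x y, connect e x y) -> 1 < #|V| -> total_dom e [set: V].
Proof.
move=> conn V_gt1; apply/total_domP => x.
have [y] : exists y, y \in ~: [set x].
  by apply/card_gt0P; rewrite -(ltn_add2l #|[set x]|) cardsC cards1.
rewrite !inE => yx; have /connectP[[|w p] /= ] := conn x y.
  by move=> _ eyx; rewrite eyx eqxx in yx.
by case/andP=> exw _ _; exists w; rewrite ?inE.
Qed.

Hypotheses (symE : symmetric e) (irrE : irreflexive e).

(** [PN] is built from closed neighbourhoods, yet it avoids [D]: a private [w] has a neighbour in
    [D], which can only be [u], so [w != u]; if [w] were in [D], it would lie in its own closed
    neighbourhood, which is removed. *)
Lemma in_PN (D : {set V}) u w : total_dom e D ->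
  reflect [/\ w \notin D, e w u & forall z, z \in D -> e w z -> z = u]
          (w \in PN e u D).
Proof.
move=> /total_domP dD; rewrite !inE; apply: (iffP andP).
  case=> /bigcupP nPN _.
  have nw z : z \in D -> z != u -> w != z /\ ~~ e z w.
    move=> zD zu; apply/andP; rewrite -negb_or; apply/negP=> wz.
    by apply: nPN; exists z; rewrite !inE ?zu.
  have priv z : z \in D -> e w z -> z = u.
    move=> zD ewz; apply/eqP/negPn/negP => zu.
    by have [_] := nw z zD zu; rewrite symE ewz.
  have ewu : e w u by have [z zD ewz] := dD w; rewrite -(priv z zD ewz).
  split=> //; apply/negP=> wD; have wu: w != u.
    by apply: contraTneq ewu => ->; rewrite irrE.
  by have [] := nw w wD wu; rewrite eqxx.
case=> wD ewu priv; split; last by rewrite symE ewu orbT.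
apply/bigcupP=> -[z]; rewrite !inE => /andP[zu zD] /orP[/eqP wz|ezw].
  by rewrite wz zD in wD.
by rewrite symE in ezw; rewrite (priv z zD ezw) eqxx in zu.
Qed.

End TotalDomination.

(** * Total domination after subdividing one edge *)

Section SubdivideEdge.
Variables (V : finType) (e : rel V) (u v : V).

Definition cut_edge : rel V := fun x w => e x w && ([set x; w] != [set u; v]).

Lemma cut_edgeW x w : cut_edge x w -> e x w.
Proof. by case/andP. Qed.

Lemma cut_edge_uv : cut_edge u v = false.
Proof. by rewrite /cut_edge eqxx andbF. Qed.

Lemma cut_edge_vu : cut_edge v u = false.
Proof. by rewrite /cut_edge setUC eqxx andbF. Qed.

Lemma cut_edge_other x w : e x w -> x != u -> x != v -> cut_edge x w.
Proof.
move=> exw xu xv; rewrite /cut_edge exw; apply/eqP=> /setP/(_ x).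
by rewrite !inE eqxx (negPf xu) (negPf xv).
Qed.

Lemma cut_edge_u w : e u w -> w != v -> w != u -> cut_edge u w.
Proof.
move=> euw wv wu; rewrite /cut_edge euw; apply/eqP=> /setP/(_ w).
by rewrite !inE eqxx (negPf wu) (negPf wv) orbT.
Qed.

Lemma cut_edge_v w : e v w -> w != u -> w != v -> cut_edge v w.
Proof.
move=> evw wu wv; rewrite /cut_edge evw; apply/eqP=> /setP/(_ w).
by rewrite !inE eqxx (negPf wu) (negPf wv) orbT.
Qed.

(* The total dominating sets of the graph with [uv] subdivided: [D] is the set
   of original vertices, and [b] tells whether the new vertex is included. *)
Definition split_dom (D : {set V}) (b : bool) : Prop :=
  (forall x, (exists2 w, w \in D & cut_edge x w) \/ b && (x \in [set u; v])) /\
  (u \in D) || (v \in D).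

Let F := [set [set u; v]].

Definition new_vertex : {f : {set V} | f \in F} :=
  exist (fun f => f \in F) [set u; v] (set11 [set u; v]).
Local Notation new := new_vertex.

Lemma new_unique f : f = new.
Proof. by apply/val_inj/set1P/(valP f). Qed.

Lemma card_split (D : {set V + {f : {set V} | f \in F}}) :
  #|D| = #|[set x | inl x \in D]| + (inr new \in D).
Proof.
rewrite -!sum1_card big_sumType /=; congr (_ + _).
  by apply: eq_bigl => x; rewrite inE.
case: (boolP (inr new \in D)) => nD.
  by rewrite (big_pred1 new) // => f; rewrite (new_unique f) /= eqxx nD.
by rewrite big_pred0 // => f; rewrite (new_unique f) (negPf nD).
Qed.

Lemma split_domP (D : {set V + {f : {set V} | f \in F}}) :
  total_dom (@subdivide V e F) D <->
  split_dom [set x | inl x \in D] (inr new \in D).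
Proof.
split=> [/total_domP dD | [dD duv]].
  split=> [x|].
    have [[w|f] wD /=] := dD (inl x).
      by rewrite inE => xw; left; exists w; rewrite ?inE.
    by rewrite (new_unique f) /= in wD * => xf; right; rewrite wD.
  have [[w|f] wD //= ] := dD (inr new).
  by rewrite !inE => /orP[]/eqP <-; rewrite wD ?orbT.
apply/total_domP=> -[x|f].
  have [[w wD xw]|/andP[nD xuv]] := dD x; last by exists (inr new).
  by rewrite inE in wD; exists (inl w) => //=; rewrite inE.
rewrite !inE in duv; rewrite (new_unique f).
by case/orP: duv => wD; [exists (inl u) | exists (inl v)];
  rewrite //= !inE eqxx ?orbT.
Qed.

Lemma gamma_t_subdivideP : e u v -> total_dom e [set: V] ->
  gamma_t e < gamma_t (@subdivide V e F) <->
  forall D b, split_dom D b -> gamma_t e < #|D| + b.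
Proof.
move=> euv /total_domP dT.
(* The subdivided graph has a total dominating set too, so its [gamma_t] is a true minimum. *)
have dT' : total_dom (@subdivide V e F) [set: _].
  apply/split_domP; split=> [x|]; last by rewrite !inE.
  rewrite inE /=; have [w _ exw] := dT x; case: (boolP (x \in _)) => xuv.
    by right.
  move: xuv; rewrite !inE negb_or => /andP[xu xv].
  by left; exists w; [rewrite !inE | apply: cut_edge_other].
split=> [lt_g D b dDb | lt_g].
  pose D' := [set a : V + {f : {set V} | f \in F} |
                if a is inl x then x \in D else b].
  have DE : [set x | inl x \in D'] = D by apply/setP=> x; rewrite !inE.
  have bE : (inr new \in D') = b by rewrite inE.
  have <- : #|D'| = #|D| + b by rewrite card_split DE bE.
  apply: leq_trans lt_g _.
  by apply/gamma_t_min/split_domP; rewrite DE bE.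
rewrite ltnNge; apply/(gamma_t_leP _ dT') => -[D /split_domP dD].
by rewrite card_split leqNgt lt_g.
Qed.

End SubdivideEdge.

(** * Domination of the subdivided graph in terms of [e] *)

Section Increase.
Variables (V : finType) (e : rel V).
Hypotheses (symE : symmetric e) (irrE : irreflexive e).
Hypothesis domT : total_dom e [set: V].

Let adj_neq x y : e x y -> x != y.
Proof. by apply: contraTneq => ->; rewrite irrE. Qed.

Lemma split_domC u v D b : split_dom e u v D b -> split_dom e v u D b.
Proof.
case=> dD duv; split=> [x|]; last by rewrite orbC.
have [[w wD xw]|] := dD x; last by rewrite setUC; right.
by left; exists w; rewrite // /cut_edge [X in _ != X]setUC.
Qed.

(** The new vertex dominates both ends, and every other vertex keeps all its neighbours, so
    [cut_edge] can give way to [e]. *)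
Lemma split_dom_true u v (D : {set V}) :
  split_dom e u v D true <->
  (u \in D) || (v \in D) /\
  forall x, x != u -> x != v -> exists2 w, w \in D & e x w.
Proof.
split=> [[dD duv] | [duv dD]]; split=> // x.
  move=> xu xv; have [[w wD /cut_edgeW xw]|] := dD x; first by exists w.
  by rewrite !inE (negPf xu) (negPf xv).
case: (boolP (x \in _)); first by right.
rewrite !inE negb_or => /andP[xu xv]; left.
by have [w wD xw] := dD x xu xv; exists w; last exact: cut_edge_other.
Qed.

Lemma split_dom_false u v (D : {set V}) :
  split_dom e u v D false <->
  [/\ (u \in D) || (v \in D), total_dom e D,
      exists2 w, w \in D :\ v & e u w & exists2 w, w \in D :\ u & e v w].
Proof.
split=> [[dD duv] | [duv /total_domP dD [w wD uw] [z zD vz]]].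
  have {}dD x : exists2 w, w \in D & cut_edge e u v x w.
    by have [//|/andP[]] := dD x.
  split=> //.
  - apply/total_domP=> x; have [w wD /cut_edgeW xw] := dD x.
    by exists w.
  - have [w wD uw] := dD u; exists w; last exact: cut_edgeW uw.
    by rewrite !inE wD andbT; apply: contraTneq uw => ->; rewrite cut_edge_uv.
  have [w wD vw] := dD v; exists w; last exact: cut_edgeW vw.
  by rewrite !inE wD andbT; apply: contraTneq vw => ->; rewrite cut_edge_vu.
split=> // x; left; case: (eqVneq x u) => [->|xu].
  move: wD; rewrite !inE => /andP[wv wD]; exists w => //.
  by apply: cut_edge_u => //; rewrite eq_sym adj_neq.
case: (eqVneq x v) => [->|xv].
  move: zD; rewrite !inE => /andP[zu zD]; exists z => //.
  by apply: cut_edge_v => //; rewrite eq_sym adj_neq.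
by have [y yD xy] := dD x; exists y; last exact: cut_edge_other.
Qed.

Lemma other_nbh (D : {set V}) x y : y \in D -> e x y ->
  onbh e x :&: D <> [set y] -> exists2 z, z \in D :\ y & e x z.
Proof.
move=> yD xy nD; apply/exists_inP; apply: contra_notT nD => /exists_inPn noz.
apply/setP=> z; rewrite !inE; apply/andP/eqP=> [[xz zD]|->] //.
by apply: contraTeq xz => zy; apply: noz; rewrite !inE zy.
Qed.

Lemma PN_nbh (D : {set V}) x y : total_dom e D -> y \in D -> x \notin D ->
  e x y -> x \notin PN e y D -> exists2 z, z \in D :\ y & e x z.
Proof.
move=> dD yD xD xy nPN; apply: other_nbh => // eqN; case/negP: nPN.
apply/in_PN => //; split=> // z zD xz.
by apply/set1P; rewrite -eqN !inE xz.
Qed.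

(** For an edge [uv] this means that subdividing it raises [gamma_t], by [gamma_t_subdivideP]. *)
Definition subdivision_resistant u v : Prop :=
  forall D b, split_dom e u v D b -> gamma_t e < #|D| + b.

Lemma subdivision_resistantC u v :
  subdivision_resistant u v -> subdivision_resistant v u.
Proof. by move=> nS D b /split_domC; apply: nS. Qed.

(** * Pendant edges *)

Lemma leaf_nbh u v w : leaf e u -> e u v -> e u w -> w = v.
Proof.
case/cards1P=> a ua uv uw; have : w \in onbh e u by rewrite inE.
have : v \in onbh e u by rewrite inE.
by rewrite ua => /set1P-> /set1P->.
Qed.

Lemma pendant_edgeP u v : leaf e u -> e u v ->
  subdivision_resistant u v <-> (forall D, gamma_t_set e D -> u \notin D).
Proof.
move=> lu uv; have only_v w : e u w -> w = v by apply: leaf_nbh lu uv.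
split=> [nS D /andP[/total_domP dD /eqP cD] | noD D b dD].
  (* Exchange [u] for the new vertex: [v] stays in the set as the only neighbour of [u], and only
     [v] can lose a dominator, but the new vertex dominates it. *)
  apply/negP=> uD; have /nS : split_dom e u v (D :\ u) true.
    apply/split_dom_true; split=> [|x xu xv].
      have [w wD uw] := dD u; rewrite -(only_v w uw) !inE wD.
      by rewrite [w == u]eq_sym (adj_neq uw) orbT.
    have [w wD xw] := dD x; exists w => //; rewrite !inE wD andbT.
    apply: contraNneq xv => wu; apply/eqP/only_v.
    by rewrite symE -wu.
  by rewrite -cD addnC (cardsD1 u D) uD ltnn.
rewrite ltnNge; apply/negP=> leD; case: b => [|] in dD leD.
  have /split_dom_true[duv {}dD] := dD.
  pose D' := D :|: [set u; v].
  have dD' : total_dom e D'.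
    apply/total_domP=> x; case: (eqVneq x u) => [->|xu].
      by exists v; rewrite // !inE eqxx !orbT.
    case: (eqVneq x v) => [->|xv].
      by exists u; rewrite 1?symE // !inE eqxx !orbT.
    by have [w wD xw] := dD x xu xv; exists w; rewrite // !inE wD.
  have cD' : #|D'| <= gamma_t e.
    (* One end is already in [D], so adding both costs at most one vertex, which dropping the new
       vertex pays for. *)
    have cap : 0 < #|D :&: [set u; v]|.
      by case/orP: duv => wD; apply/card_gt0P; [exists u | exists v];
        rewrite !inE wD eqxx ?orbT.
    rewrite -(leq_add2r #|D :&: [set u; v]|) cardsUI cards2 (adj_neq uv).
    by apply: leq_trans (leq_add leD cap); rewrite -addnA.
  have := noD D' (gamma_t_set_small dD' cD').
  by rewrite !inE eqxx orbT.
have /split_dom_false[_ _ [w wD uw] _] := dD.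
by rewrite (only_v w uw) !inE eqxx in wD.
Qed.

(** * The condition on both ends of an edge *)

Definition edge_condition u v : Prop := forall D : {set V}, gamma_t_set e D ->
  (u \in D -> v \notin D -> v \in PN e u D) /\
  (v \in D -> u \notin D -> u \in PN e v D) /\
  (u \in D -> v \in D ->
     (onbh e u :&: D = [set v] \/ onbh e v :&: D = [set u]) /\
     (onbh e u :&: D = [set v] -> end_condition e D u v) /\
     (onbh e v :&: D = [set u] -> end_condition e D v u)).

Lemma edge_conditionC u v : edge_condition u v -> edge_condition v u.
Proof.
move=> ec D /ec[cu [cv cuv]]; split=> //; split=> // vD uD.
by have [[Nu|Nv] [? ?]] := cuv uD vD; split=> //; [right | left].
Qed.

(** Otherwise [D] alone still dominates after the subdivision: [v] has a second neighbour in [D],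
    and [u] never relied on [v]. *)
Lemma resistant_PN u v D : e u v -> subdivision_resistant u v ->
  gamma_t_set e D -> u \in D -> v \notin D -> v \in PN e u D.
Proof.
move=> uv nS /andP[dD /eqP cD] uD vD; apply/negPn/negP=> vPN.
have /nS : split_dom e u v D false; last by rewrite cD addn0 ltnn.
apply/split_dom_false; split; rewrite ?uD //.
  have /total_domP/(_ u)[w wD uw] := dD; exists w; rewrite // !inE wD andbT.
  by apply: contraNneq vD => <-.
by apply: PN_nbh; rewrite // symE.
Qed.

Lemma resistant_end_condition u v D : e u v -> subdivision_resistant u v ->
  gamma_t_set e D -> u \in D -> v \in D ->
  onbh e u :&: D = [set v] -> end_condition e D u v.
Proof.
move=> uv nS /andP[dD /eqP cD] uD vD Nu.
have dom x := total_domP _ _ dD x.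
(* No vertex of [D] can be exchanged for the new vertex, since the size would stay [gamma_t]. *)
have no_swap w : w \in D -> ~ split_dom e u v (D :\ w) true.
  by move=> wD /nS; rewrite -cD addnC (cardsD1 w D) wD ltnn.
have uv' := adj_neq uv; split.
  (* Dropping [u] is harmless: its only neighbour in [D] is [v], and its neighbours outside [D] are
     not private. *)
  apply/eqP=> PN0; apply: (no_swap u uD); apply/split_dom_true.
  split=> [|x xu xv]; first by rewrite !inE [v == u]eq_sym uv' vD orbT.
  have [w wD xw] := dom x; case: (eqVneq w u) => [wu|wu]; last first.
    by exists w; rewrite // !inE wu.
  rewrite {w}wu in wD xw; apply: PN_nbh; rewrite ?PN0 ?inE //.
  by apply: contraNN xv => xD; rewrite -in_set1 -Nu !inE symE xw.
case: (eqVneq (PN e v D) set0) => [PN0|]; last by left.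
case: (boolP [exists x in (onbh e v :&: D) :\ u, onbh e x :&: D == [set v]]).
  by case/exists_inP=> x xD /eqP Nx; right; exists x.
(* Dropping [v] is harmless: [nox] gives its neighbours in [D] other than [u] a second dominator,
   [PN0] those outside [D]. *)
move/exists_inPn=> nox; case: (no_swap v vD); apply/split_dom_true.
split=> [|x xu xv]; first by rewrite !inE uv' uD.
have [w wD xw] := dom x; case: (eqVneq w v) => [wv|wv]; last first.
  by exists w; rewrite // !inE wv.
rewrite {w}wv in wD xw; case: (boolP (x \in D)) => xD; last first.
  by apply: PN_nbh; rewrite ?PN0 ?inE.
by apply: other_nbh => //; apply/eqP/nox; rewrite !inE xu xD symE xw.
Qed.

Lemma resistant_edge_condition u v :
  e u v -> subdivision_resistant u v -> edge_condition u v.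
Proof.
move=> uv nS D gD; have vu : e v u by rewrite symE.
have nS' := subdivision_resistantC nS.
split; first exact: resistant_PN.
split; first exact: resistant_PN.
move=> uD vD; split; last by split; apply: resistant_end_condition.
case: (eqVneq (onbh e u :&: D) [set v]) => [|/eqP Nu]; first by left.
case: (eqVneq (onbh e v :&: D) [set u]) => [|/eqP Nv]; first by right.
have /andP[dD /eqP cD] := gD.
(* Both ends have a neighbour in [D] besides each other, so [D] survives the subdivision. *)
have /nS : split_dom e u v D false; last by rewrite cD addn0 ltnn.
by apply/split_dom_false; split; rewrite ?uD //; apply: other_nbh.
Qed.

Lemma edge_condition_new_vertex u v (D : {set V}) :
  e u v -> edge_condition u v -> u \in D -> v \notin D ->
  split_dom e u v D true -> gamma_t e < #|D| + 1.
Proof.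
move=> uv ec uD vD /split_dom_true[_ dD]; rewrite ltnNge; apply/negP=> leD.
have notD : ~ total_dom e D.
  by move/gamma_t_min/(leq_trans leD); rewrite addn1 ltnn.
have uv' := adj_neq uv; pose D' := v |: D.
have vD' : v \in D' by rewrite !inE eqxx.
have uD' : u \in D' by rewrite !inE uD orbT.
have dD' : total_dom e D'.
  apply/total_domP=> x; case: (eqVneq x u) => [->|xu]; first by exists v.
  case: (eqVneq x v) => [->|xv]; first by exists u; rewrite 1?symE.
  by have [w wD xw] := dD x xu xv; exists w; rewrite // !inE wD orbT.
have gD' : gamma_t_set e D'.
  by apply: gamma_t_set_small; rewrite // cardsU1 vD addnC.
(* A second neighbour of [u] would already make [D] total dominating, although it has fewer than
   [gamma_t] vertices. *)
have Nu : onbh e u :&: D' = [set v].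
  case: (eqVneq (onbh e u :&: D') [set v]) => // /eqP.
  case/(other_nbh vD' uv) => z; rewrite !inE => /andP[zv].
  rewrite (negPf zv) /= => zD uz; case: notD; apply/total_domP=> x.
  case: (eqVneq x u) => [->|xu]; first by exists z.
  case: (eqVneq x v) => [->|xv]; first by exists u; rewrite 1?symE.
  exact: dD.
(* Such a [w] is dominated by [D], which omits [v], so it cannot depend on [v] alone. This refutes
   both alternatives in the end condition. *)
have noD w : w != u -> e w v -> (forall z, z \in D' -> e w z -> z = v) -> False.
  move=> wu /adj_neq wv priv; have [z zD wz] := dD w wu wv.
  by rewrite -(priv z) // ?inE zD ?orbT in vD.
have [_ [_ cuv]] := ec D' gD'; have [_ [/(_ Nu)[_]]] := cuv uD' vD'.
case=> [/set0Pn[w /(in_PN symE irrE _ _ dD')[wD' wv priv]] | [x] + Nx] _.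
  by apply: (noD w) => //; apply: contraNneq wD' => ->.
rewrite !inE => /and3P[xu vx _]; apply: (noD x) => // [|z zD' xz].
  by rewrite symE.
by apply/set1P; rewrite -Nx in_setI zD' inE xz.
Qed.

Lemma edge_condition_resistant u v :
  e u v -> edge_condition u v -> subdivision_resistant u v.
Proof.
move=> uv ec D [] dD.
  have vu : e v u by rewrite symE.
  have /split_dom_true[duv dom] := dD.
  case: (boolP (u \in D)) => uD; case: (boolP (v \in D)) => vD.
  (* With both ends in [D] they dominate each other, so [D] is total dominating for [e]. *)
  - rewrite addn1 ltnS; apply/gamma_t_min/total_domP=> x.
    case: (eqVneq x u) => [->|xu]; first by exists v.
    case: (eqVneq x v) => [->|xv]; first by exists u.
    exact: dom.
  - exact: edge_condition_new_vertex uv ec uD vD dD.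
  - have ec' := edge_conditionC ec.
    exact: edge_condition_new_vertex vu ec' vD uD (split_domC dD).
  - by rewrite (negPf uD) (negPf vD) in duv.
rewrite addn0 ltnNge; apply/negP=> leD.
have /split_dom_false[duv domD [w wD uw] [z zD vz]] := dD.
have gD := gamma_t_set_small domD leD; have [cu [cv cuv]] := ec D gD.
(* [D] would be a [gamma_t]-set, but [w] and [z] contradict the condition wherever the ends lie. *)
have nw : onbh e u :&: D <> [set v].
  move/setP/(_ w); move: wD; rewrite !inE uw => /andP[/negPf -> ->].
  by [].
have nz : onbh e v :&: D <> [set u].
  move/setP/(_ z); move: zD; rewrite !inE vz => /andP[/negPf -> ->].
  by [].
case: (boolP (u \in D)) => uD; case: (boolP (v \in D)) => vD.
- by have [[]] := cuv uD vD.
- have /(in_PN symE irrE _ _ domD)[_ _ priv] := cu uD vD.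
  move: zD; rewrite !inE => /andP[zu zD].
  by rewrite (priv z zD vz) eqxx in zu.
- have /(in_PN symE irrE _ _ domD)[_ _ priv] := cv vD uD.
  move: wD; rewrite !inE => /andP[wv wD].
  by rewrite (priv w wD uw) eqxx in wv.
by rewrite (negPf uD) (negPf vD) in duv.
Qed.

(** * From edge sets to a single edge *)

Lemma subdivide_none : gamma_t (@subdivide V e set0) <= gamma_t e.
Proof.
have [M /andP[/total_domP dM /eqP <-]] := gamma_t_attained domT.
rewrite -(card_imset (mem M) (@inl_inj V {f : {set V} | f \in set0})).
apply/gamma_t_min/total_domP=> -[x|[f f0]]; last by have := f0; rewrite inE.
by have [w wM xw] := dM x; exists (inl w); rewrite ?imset_f //= inE andbT.
Qed.

Lemma sd_gamma_t_eq1 : 0 < #|V| ->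
  sd_gamma_t e = 1 <-> exists u v, e u v /\ subdivision_resistant u v.
Proof.
case/card_gt0P=> x0 _; have [y0 _ xy0] := total_domP _ _ domT x0.
(* With an edge present the default [#|edges e|.+1] exceeds 1, so the value 1 must come from an
   actual edge set. *)
have edges_gt0 : 0 < #|edges e|.
  by apply/card_gt0P; exists [set x0; y0]; apply/imsetP;
    exists (x0, y0); rewrite ?inE.
have sd_gt0 : 0 < sd_gamma_t e.
  rewrite ltnNge leq_bigminn /=; apply/negP=> /hasP[F _].
  rewrite leqn0 cards_eq0 => /andP[/andP[_ ltF] /eqP F0].
  by rewrite F0 ltnNge subdivide_none in ltF.
apply: (iff_trans (B := sd_gamma_t e <= 1)).
  by split=> [->|le1] //; apply/eqP; rewrite eqn_leq le1.
rewrite leq_bigminn ltnS leqNgt edges_gt0 /=; split.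
  case/hasP=> F _ /andP[/andP[sF ltF]]; rewrite leq_eqVlt => /orP[]; last first.
    rewrite ltnS leqn0 cards_eq0 => /eqP F0.
    by rewrite F0 ltnNge subdivide_none in ltF.
  case/cards1P=> f Ff; have : f \in edges e.
    by apply: (subsetP sF); rewrite Ff inE.
  case/imsetP=> -[u v]; rewrite inE /= => uv fE.
  exists u, v; split=> //; apply/gamma_t_subdivideP => //.
  by rewrite -fE -Ff.
case=> u [v [uv /(gamma_t_subdivideP uv domT) ltF]]; apply/hasP.
exists [set [set u; v]]; first exact: mem_index_enum.
rewrite ltF cards1 sub1set !andbT; apply/imsetP.
by exists (u, v); rewrite ?inE.
Qed.

End Increase.

Theorem theorem19 (V : finType) (e : rel V) :
  is_tree e -> 3 <= #|V| ->
  (sd_gamma_t e = 1 <->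
   (exists2 l : V, leaf e l &
      forall D : {set V}, gamma_t_set e D -> l \notin D) \/
   (exists u v : V, inner_edge e u v /\
      forall D : {set V}, gamma_t_set e D ->
        (u \in D -> v \notin D -> v \in PN e u D) /\
        (v \in D -> u \notin D -> u \in PN e v D) /\
        (u \in D -> v \in D ->
           (onbh e u :&: D = [set v] \/ onbh e v :&: D = [set u]) /\
           (onbh e u :&: D = [set v] -> end_condition e D u v) /\
           (onbh e v :&: D = [set u] -> end_condition e D v u)))).
Proof.
case=> symE irrE conn _ V_ge3.
(* Connectedness excludes isolated vertices. *)
have domT : total_dom e [set: V].
  by apply: connected_total_domT => //; apply: leq_trans V_ge3.
have V_gt0 : 0 < #|V| by apply: leq_trans V_ge3.
apply: (iff_trans (sd_gamma_t_eq1 domT V_gt0)); split.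
  case=> u [v [uv nS]]; have vu : e v u by rewrite symE.
  case: (boolP (leaf e u)) => lu.
    by left; exists u => //; apply/(pendant_edgeP symE irrE lu uv).
  case: (boolP (leaf e v)) => lv.
    left; exists v => //; apply/(pendant_edgeP symE irrE lv vu).
    exact: subdivision_resistantC.
  right; exists u, v; split; first by rewrite /inner_edge uv lu.
  exact: resistant_edge_condition.
case=> [[l ll noD] | [u [v [/and3P[uv _ _] ec]]]].
  have [w _ lw] := total_domP _ _ domT l.
  by exists l, w; split=> //; apply/pendant_edgeP.
by exists u, v; split=> //; apply: edge_condition_resistant.
Qed.
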